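(* Let $M$ be a compact Riemannian manifold with normalized Lebesgue measure $m$, and let $f\colon M\to M$ be Borel measurable. Let $K\subset M$ be a statistical attractor for $f$ and let $B(K)$ be its basin. Then there exists a unique nonempty weak$^*$-compact set $\mathcal O_f(K)$ of Borel probability measures on $M$ (called SRB-like measures) such that: (a) For Lebesgue almost every $x\in B(K)$, and for every weak$^*$-convergent subsequence of the empirical distributions $\nu_n(x)=\frac1n\sum_{j=0}^{n-1}\delta_{f^j(x)}$, the weak$^*$-limit of the subsequence belongs to $\mathcal O_f(K)$. (b) $\mathcal O_f(K)$ is the minimum weak$^*$-compact set of probability measures satisfying (a). (c) $\mu(K)=1$ for all $\mu\in\mathcal O_f(K)$. (d) If besides $K$ is minimal $\alpha$-observable for some $0<\alpha\le1$, then $K$ is the minimal compact set in $M$ such that $\mu(K)=1$ for all $\mu\in\mathcal O_f(K)$.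
   Context: For a nonempty compact set $K\subset M$, its basin of statistical attraction is $$B(K)=\Big\{x\in M:\ \lim_{n\to+\infty}\frac1n\,\#\{0\le j\le n-1:\ \mathrm{dist}(f^j(x),K)<\epsilon\}=1\ \ \forall\,\epsilon>0\Big\}.$$ A nonempty compact set $K$ with $m(B(K))>0$ is called a statistical attractor (no minimality is required for this terminology). For $0<\alpha\le1$, $K$ is $\alpha$-observable if $m(B(K))\ge\alpha$; it is minimal $\alpha$-observable if it is $\alpha$-observable and no proper nonempty compact subset of $K$ is $\alpha$-observable for the same $\alpha$. $\delta_y$ denotes the Dirac measure at $y$. The space $\mathcal M$ of Borel probability measures on $M$ carries the weak$^*$ topology. *)

(* Defs.v *)
From HB Require Import structures.
From mathcomp Require Import all_boot all_order all_algebra.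
From mathcomp Require Import all_classical all_reals all_analysis.

Set Implicit Arguments.
Unset Strict Implicit.
Unset Printing Implicit Defensive.

Import Order.TTheory GRing.Theory Num.Theory.
Import numFieldNormedType.Exports.

Local Open Scope classical_set_scope.
Local Open Scope ring_scope.

(** * Riemannian manifolds *)

(* A nonempty metric space: the library requires a distinguished point on every
   measurable type. *)
#[short(type="pmetricType")]
HB.structure Definition PointedMetric (K : numDomainType) :=
  { M of Metric K M & Pointed M }.

Section smooth.
Context {R : realType} {V W : normedModType R}.

(* Only meaningful for [U] open and [V] finite-dimensional. *)
Fixpoint Ck (k : nat) (U : set V) (f : V -> W) : Prop :=
  (forall x, U x -> {for x, continuous f}) /\
  if k is k'.+1 then
    forall v, (forall x, U x -> derivable f x v) /\ Ck k' U ('D_v f)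
  else True.

Definition smooth_on (U : set V) (f : V -> W) := forall k, Ck k U f.

End smooth.

Record atlas (R : realType) (n : nat) (M : topologicalType) := Atlas {
  chart : Type ;
  dom : chart -> set M ;
  coords : chart -> M -> 'rV[R]_n ;
  param : chart -> 'rV[R]_n -> M ;
  dom_open : forall i, open (dom i) ;
  dom_cover : \bigcup_i dom i = [set: M] ;
  coordsK : forall i x, dom i x -> param i (coords i x) = x ;
  coords_open : forall i, open (coords i @` dom i) ;
  coords_continuous : forall i x, dom i x -> {for x, continuous (coords i)} ;
  param_continuous : forall i y, (coords i @` dom i) y ->
    {for y, continuous (param i)} ;
  transition_smooth : forall i j,
    smooth_on (coords i @` (dom i `&` dom j)) (coords j \o param i)
}.

Section riemannian_metric.
Context {R : realType} {n : nat} {M : topologicalType} (A : atlas R n M).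

(* [G i y] is the Gram matrix, at the point with coordinates [y] in the chart
   [i], of the inner product on the tangent space in the coordinate basis.
   Tangent vectors are row vectors, and ['J tau y] acts on their right, hence
   the transformation rule. *)
Record riemannian_metric := RiemannianMetric {
  gram : chart A -> 'rV[R]_n -> 'M[R]_n ;
  gram_smooth : forall i, smooth_on (coords i @` dom i) (gram i) ;
  gram_sym : forall i y, (coords i @` dom i) y -> (gram i y)^T = gram i y ;
  gram_pos : forall i y, (coords i @` dom i) y ->
    forall v : 'rV[R]_n, v != 0 -> 0 < (v *m gram i y *m v^T) ord0 ord0 ;
  gram_transition : forall i j y, (coords i @` (dom i `&` dom j)) y ->
    let tau := coords j \o param i in
    gram i y = 'J tau y *m gram j (tau y) *m ('J tau y)^T
}.

Variable g : riemannian_metric.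

Definition speed (i : chart A) (c : R -> 'rV[R]_n) (t : R) : R :=
  Num.sqrt ((derive1 c t *m gram g i (c t) *m (derive1 c t)^T) ord0 ord0).

(* [path_length x y l]: some piecewise C^1 path from [x] to [y], each piece of
   which stays in one chart, has length [l].  A C^1 curve on [0, 1] is taken as
   the restriction of a C^1 curve on the whole line. *)
Inductive path_length (x : M) : M -> R -> Prop :=
| path_nil : path_length x x 0
| path_cons (i : chart A) (c : R -> 'rV[R]_n) (l : R) :
    path_length x (param i (c 0)) l ->
    (forall t, derivable c t 1) -> continuous (derive1 c) ->
    (forall t, 0 <= t <= 1 -> (coords i @` dom i) (c t)) ->
    path_length x (param i (c 1))
      (l + \int[lebesgue_measure]_(t in `[0, 1]) speed i c t).

End riemannian_metric.

(* The distance between two points of the same component is the Riemannian one;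
   between points of distinct components (where the infimum would be infinite)
   it is unconstrained, except that the metric induces the topology of [M]. *)
Record riemannian_manifold (R : realType) (n : nat) (M : pmetricType R) :=
  RiemannianManifold {
  mfd_atlas : atlas R n M ;
  mfd_metric : riemannian_metric mfd_atlas ;
  mfd_dist : forall (x y : M) (l : R), path_length mfd_metric x y l ->
    mdist x y = inf [set s | path_length mfd_metric x y s]
}.

Definition borel (T : ptopologicalType) := g_sigma_algebraType (@open T).

Section volume.
Context {R : realType} {n : nat}.

(* This characterizes Lebesgue measure on the Borel sets of R^n. *)
Definition is_lebesgue (lam : {measure set (borel 'rV[R]_n) -> \bar R}) :=
  forall a b : 'rV[R]_n, (forall j, a ord0 j <= b ord0 j) ->
    lam [set v : 'rV[R]_n | forall j, a ord0 j <= v ord0 j <= b ord0 j] =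
    (\prod_j (b ord0 j - a ord0 j))%:E.

Context {M : pmetricType R} (g : riemannian_manifold n M).

Definition is_riemannian_volume (vol : {measure set (borel M) -> \bar R}) :=
  exists2 lam : {measure set (borel 'rV[R]_n) -> \bar R}, is_lebesgue lam &
  forall (i : chart (mfd_atlas g)) (A : set (borel M)),
    measurable A -> A `<=` dom i ->
    vol A = (\int[lam]_(y in coords i @` A)
               (Num.sqrt (\det (gram (mfd_metric g) i y)))%:E)%E.

Definition is_normalized_volume (m : probability (borel M) R) :=
  exists2 vol, is_riemannian_volume vol &
  forall A, measurable A -> m A = (vol A * ((fine (vol setT))^-1)%:E)%E.

End volume.

(** * Borel probability measures and the weak* topology *)

Section borel_prob.
Context {R : realType} {M : pmetricType R}.

(* A measure of the library is a function on all sets, with arbitrary values on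
   nonmeasurable ones.  Requiring the value 0 there makes equality of
   [borel_prob] coincide with equality on Borel sets; otherwise the weak*
   topology would not separate distinct elements. *)
Record borel_prob := BorelProb {
  bprob :> probability (borel M) R ;
  bprob_nonmeasurable :
    `[< forall A : set (borel M), ~ measurable A -> bprob A = 0%E >]
}.

HB.instance Definition _ := [isSub for bprob].
HB.instance Definition _ := [Choice of borel_prob by <:].

Definition weak_star_eval (mu : borel_prob)
    : prod_topology (fun _ : continuousType M R => (R : topologicalType)) :=
  fun phi => \int[mu]_x phi x.

HB.instance Definition _ :=
  Topological.copy borel_prob (initial_topology weak_star_eval).

End borel_prob.
Arguments borel_prob {R} M.

Section restrict_borel.
Context {R : realType} {M : pmetricType R} (P : probability (borel M) R).

Definition mborel (A : set (borel M)) : \bar R :=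
  if `[< measurable A >] then P A else 0%E.

Local Lemma mborelE A : measurable A -> mborel A = P A.
Proof. by move=> mA; rewrite /mborel asboolT. Qed.

Local Lemma mborel0 : mborel set0 = 0%E.
Proof. by rewrite mborelE// measure0. Qed.

Local Lemma mborel_ge0 A : (0 <= mborel A)%E.
Proof. by rewrite /mborel; case: ifP. Qed.

Local Lemma mborel_sigma_additive : semi_sigma_additive mborel.
Proof.
move=> F mF tF mUF; rewrite (mborelE mUF).
under eq_fun do under eq_bigr do rewrite mborelE//.
exact: measure_semi_sigma_additive.
Qed.

HB.instance Definition _ := isMeasure.Build _ _ _ mborel
  mborel0 mborel_ge0 mborel_sigma_additive.

Local Lemma mborel_setT : mborel setT = 1%E.
Proof. by rewrite mborelE// probability_setT. Qed.

HB.instance Definition _ :=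
  Measure_isProbability.Build _ _ _ mborel mborel_setT.

Local Lemma mborel_nonmeasurable :
  `[< forall A : set (borel M), ~ measurable A -> mborel A = 0%E >].
Proof. by apply/asboolP => A mA; rewrite /mborel asboolF. Qed.

Definition to_borel_prob : borel_prob M :=
  @BorelProb R M mborel mborel_nonmeasurable.

End restrict_borel.

(** * Empirical distributions, basins and attractors *)

Section empirical.
Context {R : realType} {M : pmetricType R} (f : borel M -> borel M).

Definition empirical_measure (n : nat) (x : borel M) : set (borel M) -> \bar R :=
  mscale (n.+1%:R^-1)%:nng
    (msum (fun j => \d_(iter j f x) : {measure set _ -> \bar R}) n.+1).

HB.instance Definition _ n x := Measure.on (empirical_measure n x).

Local Lemma empirical_setT n x : empirical_measure n x setT = 1%E.
Proof.
rewrite /empirical_measure /mscale/= /msum/=.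
under eq_bigr do rewrite diracT.
by rewrite sumEFin sumr_const card_ord -EFinM mulVf.
Qed.

HB.instance Definition _ n x :=
  Measure_isProbability.Build _ _ _ (empirical_measure n x) (empirical_setT n x).

(* [empirical n x] is nu_(n + 1)(x), as nu_0 is undefined. *)
Definition empirical (n : nat) (x : borel M) : borel_prob M :=
  to_borel_prob (empirical_measure n x).

End empirical.

Section attractors.
Context {R : realType} {M : pmetricType R} (f : borel M -> borel M).

Definition basin (K : set M) : set (borel M) :=
  [set x | forall eps : R, 0 < eps ->
    #|[pred j : 'I_n | (edist_inf K (iter j f x) < eps%:E)%E]|%:R / n%:R
      @[n --> \oo] --> (1 : R)].

Variable m : probability (borel M) R.

Definition statistical_attractor (K : set M) :=
  [/\ K !=set0, compact K & (0 < m (basin K))%E].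

Definition observable (alpha : R) (K : set M) :=
  [/\ K !=set0, compact K & (alpha%:E <= m (basin K))%E].

Definition minimal_observable (alpha : R) (K : set M) :=
  observable alpha K /\ forall K' : set M, K' `<` K -> ~ observable alpha K'.

(* [O] contains the weak* limit of every convergent subsequence of
   the empirical distributions of almost every point of the basin. *)
Definition captures_limits (K : set M) (O : set (borel_prob M)) :=
  {ae m, forall x, basin K x ->
    forall sigma : nat -> nat, {homo sigma : i j / (i < j)%N} ->
    forall mu : borel_prob M,
      empirical f (sigma k) x @[k --> \oo] --> mu -> O mu}.

End attractors.

(* Main.v *)
(* The set O consists of the measures mu such that, for every weak* neighbourhood
   U of mu, the points of B(K) whose empirical distributions accumulate in U do
   not form a null set.  The space of Borel probability measures is weak*
   compact and has a countable basis.  Hence O is compact, and a.e. point of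
   B(K) accumulates only on O, because the complement of O is a countable union
   of basic open sets on which almost no point accumulates.  Any compact set
   with this property contains O.  For (c) and (d), with d the distance to K,
   a point lies in B(K) iff the Birkhoff means of d tend to 0, and mu K = 1 iff
   the integral of d is 0; so O sits in the closed set of measures integrating
   d to 0, and if O is concentrated on K' then a.e. point of B(K) lies in
   B(K `&` K'), which contradicts minimality unless K is contained in K'. *)
Require Import Defs.
From HB Require Import structures.
From mathcomp Require Import all_boot all_order all_algebra finmap lra.
From mathcomp Require Import all_classical all_reals all_analysis.
From mathcomp Require Import measurable_realfun.

Set Implicit Arguments.
Unset Strict Implicit.
Unset Printing Implicit Defensive.

Import Order.TTheory GRing.Theory Num.Theory.
Import numFieldNormedType.Exports.

Local Open Scope classical_set_scope.
Local Open Scope ring_scope.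

(** * Measures dominating a content on closed sets *)

Section closed_content.
Context {R : realType} {T : ptopologicalType}.

Lemma borel_open (U : set T) : open U -> measurable (U : set (borel T)).
Proof. by move=> oU; exact: sub_sigma_algebra. Qed.

Lemma borel_closed (C : set T) : closed C -> measurable (C : set (borel T)).
Proof.
by move=> cC; rewrite -[C]setCK; apply: measurableC; apply: borel_open; rewrite openC.
Qed.

(** These properties of a probability on closed sets survive limits along an ultrafilter. Values on
    other sets are unconstrained. *)
Record closed_content := ClosedContent {
  ccontent :> set T -> R ;
  ccontentS : forall C D, closed C -> closed D -> C `<=` D ->
    ccontent C <= ccontent D ;
  ccontentU : forall C D, closed C -> closed D ->
    ccontent (C `|` D) <= ccontent C + ccontent D ;
  ccontent_disjU : forall C D, closed C -> closed D -> C `&` D = set0 ->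
    ccontent (C `|` D) = ccontent C + ccontent D ;
  ccontentT : ccontent setT = 1
}.

Variable p : closed_content.
Local Open Scope ereal_scope.

(* The value on nonopen sets makes the outer measure [mu_ext inner_content] an
   infimum over countable covers by open sets. *)
Definition inner_content (U : set (borel T)) : \bar R :=
  if `[< open (U : set T) >] then
    ereal_sup [set (p C)%:E | C in [set C | closed C /\ C `<=` U]]
  else +oo.

Lemma inner_contentE U : open (U : set T) ->
  inner_content U = ereal_sup [set (p C)%:E | C in [set C | closed C /\ C `<=` U]].
Proof. by move=> oU; rewrite /inner_content asboolT. Qed.

Lemma ccontent0 : p set0 = 0%R.
Proof.
have := @ccontent_disjU p set0 set0 (@closed0 _) (@closed0 _) (setI0 _).
by rewrite setU0 => /eqP; rewrite -subr_eq0 opprD addNKr oppr_eq0 => /eqP.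
Qed.

Lemma inner_content_lb C U : closed C -> open (U : set T) -> C `<=` U ->
  (p C)%:E <= inner_content U.
Proof.
by move=> cC oU CU; rewrite inner_contentE//; apply: ereal_sup_ubound; exists C.
Qed.

Lemma inner_content_ge0 U : 0 <= inner_content U.
Proof.
rewrite /inner_content; case: asboolP => oU; last exact: leey.
rewrite -[0]/(0%R%:E) -ccontent0; apply: ereal_sup_ubound.
by exists set0 => //; split => //; exact: closed0.
Qed.

Lemma inner_content0 : inner_content set0 = 0.
Proof.
rewrite inner_contentE; last exact: open0.
apply/eqP; rewrite eq_le; apply/andP; split.
  apply: ge_ereal_sup => _ [C [_ C0] <-].
  by rewrite (_ : C = set0) ?ccontent0 // -subset0.
rewrite -[0]/(0%R%:E) -ccontent0; apply: ereal_sup_ubound.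
by exists set0 => //; split => //; exact: closed0.
Qed.

Lemma inner_content_le1 U : open (U : set T) -> inner_content U <= 1.
Proof.
move=> oU; rewrite inner_contentE//; apply: ge_ereal_sup => _ [C [cC CU] <-].
rewrite lee_fin -(ccontentT p); apply: ccontentS => //; exact: closedT.
Qed.

Local Notation mu := (mu_ext inner_content).

Let mu0 : mu set0 = 0 := mu_ext0 inner_content0 inner_content_ge0.

Lemma mu_ext_inner_content_le U : open (U : set T) -> mu U <= inner_content U.
Proof.
move=> oU; apply: ereal_inf_lbound; exists (fun n => if n is 0%N then U else set0).
  by split=> [[]// |t Xt]; [exact: borel_open|exists 0%N].
apply/cvg_lim => //; rewrite -cvg_shiftS.
rewrite (_ : [sequence _]_n = cst (inner_content U)); first exact: cvg_cst.
rewrite funeqE => n /=; rewrite big_nat_recl//= big1 ?adde0// => i _.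
exact: inner_content0.
Qed.

(** Let [C] be closed in both [U] and [V]. The part of [V] outside [U] lies in the open set of
    points of [V] outside [C]. Closed subsets [D] of the latter are disjoint from [C], so the
    contents of [C] and [D] add up to at most that of [V]. Suprema over [D], then over [C], give the
    bound. *)
Lemma inner_content_split U V : open (U : set T) -> open (V : set T) ->
  mu (V `&` U) + mu (V `&` ~` U) <= inner_content V.
Proof.
move=> oU oV; have VU : open (V `&` U : set T) by exact: openI.
have fV : inner_content V \is a fin_num.
  by rewrite ge0_fin_numE ?inner_content_ge0// (le_lt_trans (inner_content_le1 oV))// ltry.
have step C : closed C -> C `<=` V `&` U ->
    (p C)%:E + mu (V `&` ~` U) <= inner_content V.
  move=> cC CVU; have oVC : open (V `&` ~` C : set T).
    by apply: openI => //; exact: closed_openC.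
  rewrite addeC -leeBrDr//.
  apply: (@le_trans _ _ (mu (V `&` ~` C))).
    by apply: le_mu_ext => x [Vx nUx]; split => // /CVU[].
  apply: le_trans (mu_ext_inner_content_le oVC) _.
  rewrite inner_contentE//; apply: ge_ereal_sup => _ [D [cD DVC] <-].
  rewrite leeBrDr// -EFinD -ccontent_disjU//; last first.
    by rewrite -subset0 => x [/DVC[]].
  apply: inner_content_lb => //; first exact: closedU.
  by move=> x [/DVC[]|/CVU[]].
(* Subtraction needs finiteness, which is the case of the empty [C] in [step]. *)
have f2 : mu (V `&` ~` U) \is a fin_num.
  rewrite ge0_fin_numE; last by apply: mu_ext_ge0; exact: inner_content_ge0.
  apply: le_lt_trans (ltry 1).
  apply: le_trans (inner_content_le1 oV).
  have := step set0 (@closed0 _) (@sub0set _ _).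
  by rewrite ccontent0 add0e.
rewrite -leeBrDr//; apply: le_trans (mu_ext_inner_content_le VU) _.
rewrite inner_contentE//; apply: ge_ereal_sup => _ [C [cC CVU] <-].
by rewrite leeBrDr// step.
Qed.

Let mu_outer : {outer_measure set (borel T) -> \bar R} :=
  HB.pack mu (isOuterMeasure.Build R (borel T) mu mu0
    (mu_ext_ge0 inner_content_ge0) (le_mu_ext inner_content)
    (mu_ext_sigma_subadditive inner_content_ge0)).

(** A cover with a nonopen member has infinite total content, so the Caratheodory inequality for an
    arbitrary test set reduces to splitting open sets. *)
Lemma open_caratheodory U : open (U : set T) -> mu.-caratheodory U.
Proof.
move=> oU; apply: (@le_caratheodory_measurable _ _ mu_outer) => X.
apply: le_ereal_inf_tmp => _ [B [mB XB] <-].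
have ge0 := @outer_measure_ge0 _ _ mu_outer.
apply: (@le_trans _ _ (\sum_(k <oo) (mu (B k `&` U) + mu (B k `&` ~` U)))).
  rewrite nneseriesD; [|by move=> *; exact: ge0|by move=> *; exact: ge0].
  apply: leeD.
    apply: le_trans (outer_measure_sigma_subadditive mu_outer _).
    by apply: le_mu_ext => x [/XB[k _ Bk] Ux]; exists k.
  apply: le_trans (outer_measure_sigma_subadditive mu_outer _).
  by apply: le_mu_ext => x [/XB[k _ Bk] Ux]; exists k.
apply: lee_nneseries => [k _ _|k _]; first by apply: adde_ge0; exact: ge0.
have [oB|nB] := pselect (open (B k : set T)); first exact: inner_content_split.
by rewrite /inner_content asboolF// leey.
Qed.

Lemma borel_caratheodory (A : set (borel T)) : measurable A -> mu.-caratheodory A.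
Proof.
apply: (@smallest_sub _ _ open (mu.-caratheodory)); last exact: open_caratheodory.
split; first exact: (caratheodory_measurable_set0 mu_outer).
  by move=> B mB; rewrite setTD; exact: (@caratheodory_measurable_setC _ _ mu_outer).
by move=> F mF; exact: (@caratheodory_measurable_bigcup _ _ mu_outer).
Qed.

Lemma ccontent_bigU (F : nat -> set T) n : (forall i, closed (F i)) ->
  (p (\big[setU/set0]_(i < n) F i) <= \sum_(i < n) p (F i))%R.
Proof.
move=> cF; elim: n => [|n ih]; first by rewrite !big_ord0 ccontent0.
rewrite !big_ord_recr/=; apply: le_trans (ccontentU _ _ _) _ => //.
  by apply: closed_bigsetU.
by rewrite lerD2r.
Qed.

Hypothesis cptT : compact [set: T].
Hypothesis regT : regular_space T.

(* Given an open cover of [C], regularity and compactness cover [C] by finitely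
   many closed sets, each contained in a single member of the cover. *)
Lemma le_ccontent_mu_ext C : closed C -> (p C)%:E <= mu C.
Proof.
move=> cC; apply: le_ereal_inf_tmp => _ [B [mB CB] <-].
have [/existsNP[k nBk]|/contrapT oB] :=
    pselect (~ forall k, open (B k : set T)).
  rewrite (@nneseries_pinfty _ _ _ k) ?leey// => [n _|].
    exact: inner_content_ge0.
  by rewrite /inner_content asboolF.
have /choice[W nW] x : exists Wk : set T * nat,
    C x -> [/\ open Wk.1, Wk.1 x & closure Wk.1 `<=` B Wk.2].
  have [Cx|nCx] := pselect (C x); last by exists (set0, 0%N).
  have [k _ Bkx] := CB _ Cx.
  have [V nV VB] : filter_from (nbhs x) closure (B k).
    by apply: regT; exact: open_nbhs_nbhs.
  exists (V°, k) => _; split => //=; first exact: open_interior.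
  by apply: subset_trans VB; apply: closureS; exact: interior_subset.
have cptC : compact C by exact: subclosed_compact cptT _.
move: (cptC); rewrite compact_cover => /(_ T C (fst \o W))[].
- by move=> x /nW[].
- by move=> x Cx; exists x => //; have [] := nW _ Cx.
(* [F n] gathers, inside [C], the closures assigned to the member [B n] of the cover; only indices
   below [N] occur. *)
move=> D DC CD; pose N := (\max_(x <- D) (W x).2).+1.
pose F n := C `&` \bigcup_(x in [set` D] `&` [set x | (W x).2 = n]) closure (W x).1.
have cF n : closed (F n).
  apply: closedI => //; apply: closed_bigcup => [|x _]; last exact: closed_closure.
  by apply: sub_finite_set (finite_fset D) => x [].
have FB n : F n `<=` B n.
  move=> x [_ [y [/= yD <-]]] yx.
  by have [_ _] := nW y (set_mem (DC _ yD)); exact.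
apply: (@le_trans _ _ (\sum_(i < N) p (F i))%R%:E).
  rewrite lee_fin; apply: le_trans (ccontent_bigU _ cF).
  apply: ccontentS => //; first by apply: closed_bigsetU.
  move=> x Cx; have [y /= yD Wyx] := CD _ Cx.
  rewrite -bigcup_mkord; exists (W y).2 => /=.
    by rewrite ltnS; exact: (@leq_bigmax_seq _ _ xpredT (fun x => (W x).2) y).
  by split => //; exists y => //; exact: subset_closure.
apply: (@le_trans _ _ (\sum_(0 <= i < N) inner_content (B i))); last first.
  by apply: nneseries_lim_ge => *; exact: inner_content_ge0.
rewrite big_mkord -sumEFin; apply: lee_sum => i _.
exact: inner_content_lb.
Qed.

Lemma closed_content_dominated :
  exists P : probability (borel T) R, forall C, closed C -> (p C)%:E <= P C.
Proof.
have sa : semi_sigma_additive (mu : set (borel T) -> \bar R).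
  move=> F mF tF mUF.
  have := @caratheodory_measure_sigma_additive _ (borel T) mu_outer.
  apply => //; first by move=> i; apply: borel_caratheodory; exact: mF.
  apply: borel_caratheodory; exact: mUF.
have [nu nuE] : exists nu : {measure set (borel T) -> \bar R},
    nu = mu :> (set (borel T) -> \bar R).
  pose mA := isMeasure.Build _ (borel T) R mu mu0 (mu_ext_ge0 inner_content_ge0) sa.
  pose nu : {measure set (borel T) -> \bar R} :=
    HB.pack (mu : set (borel T) -> \bar R) mA.
  by exists nu.
have nu1 : nu setT = 1.
  rewrite nuE; apply/eqP; rewrite eq_le; apply/andP; split.
    by apply: le_trans (mu_ext_inner_content_le _) (inner_content_le1 _); exact: openT.
  by rewrite -[1]/(1%R%:E) -(ccontentT p); apply: le_ccontent_mu_ext; exact: closedT.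
(* The total mass is already 1: [mnormalize] changes no value and only packages [nu] as a
   probability. *)
exists (mnormalize nu point) => C cC.
by rewrite /= /mnormalize nu1 onee_eq0/= invr1 mule1 nuE; exact: le_ccontent_mu_ext.
Qed.

End closed_content.

(** * Weak* compactness *)

Lemma cvg_initial_topology (S : choiceType) (T : topologicalType) (f : S -> T)
    (F : set_system S) (s : S) :
  Filter F -> f @ F --> f s -> F --> (s : initial_topology f).
Proof.
move=> FF fF A /=; rewrite nbhsE => -[B [[C oC <-] Cs] BA].
apply: filterS BA _; exact/fF/open_nbhs_nbhs.
Qed.

(** The image filter has a cluster point in a compact segment, and an ultrafilter converges to each
    of its cluster points. *)
Lemma ultra_cvg_bounded {R : realType} {T : Type} (F : set_system T)
    (g : T -> R) (B : R) : UltraFilter F -> (forall x, `|g x| <= B) ->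
  cvg (g x @[x --> F]).
Proof.
move=> FU gB; have := @segment_compact R (- B) B.
move=> /(_ (g @ F) _)[|l [_ lF]].
  by apply: (@filterS _ F _ setT) => [x _|]; rewrite /= ?in_itv/= -?ler_norml//; exact: filterT.
apply: (cvgP l) => U Ul; have [//|FnU] := in_ultra_setVsetC (g @^-1` U) FU.
by have [y [/=]] := lF (~` U) U FnU Ul.
Qed.

Section weak_star.
Context {R : realType} {M : pmetricType R}.
Implicit Types (phi : M -> R) (mu nu : borel_prob M).

Lemma continuous_borel_measurable phi :
  continuous phi -> measurable_fun [set: borel M] (phi : borel M -> R).
Proof.
move=> /continuousP cphi; apply: (measurability _ (RGenOpens.measurableE R)).
move=> _ [_ [a [b ->] <-]]; rewrite setTI; apply: borel_open.
exact/cphi/interval_open.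
Qed.

Lemma weak_star_eval_continuous phi : continuous phi ->
  continuous (fun mu => \int[mu]_x phi x).
Proof.
move=> cphi mu.
have ce : {for mu, continuous (@weak_star_eval R M)}.
  exact: (@initial_continuous _ _ (@weak_star_eval R M)).
pose T := prod_topology (fun _ : continuousType M R => (R : topologicalType)).
have cp : continuous (fun u : T => u (mkcts cphi)).
  exact: (@proj_continuous _ (fun _ : continuousType M R => (R : topologicalType)) (mkcts cphi)).
exact: (@continuous_comp _ T _ (@weak_star_eval R M) (fun u : T => u (mkcts cphi)) mu ce (cp _)).
Qed.

Lemma cvg_weak_star (F : set_system (borel_prob M)) mu : Filter F ->
  (forall phi, continuous phi ->
    (fun nu : borel_prob M => \int[nu]_x phi x) @ F --> \int[mu]_x phi x) -> F --> mu.
Proof.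
move=> FF cF; apply: (@cvg_initial_topology _ _ (@weak_star_eval R M)).
apply/cvg_sup => phi; apply: cvg_initial_topology; apply: cF.
exact: cts_fun.
Qed.

Hypothesis cptM : compact [set: M].

Lemma continuous_bounded_ex phi :
  continuous phi -> exists2 B, 0 < B & forall x, `|phi x| <= B.
Proof.
move=> cphi.
have : compact (phi @` setT).
  by apply: continuous_compact => //; exact: continuous_subspaceT.
move=> /compact_bounded[N [_ Nphi]].
exists (`|N| + 1) => [|x]; first by rewrite ltr_wpDl.
by apply: Nphi; [rewrite (le_lt_trans (ler_norm _))// ltrDl|exists x].
Qed.

Lemma continuous_integrable (P : probability (borel M) R) phi :
  continuous phi -> P.-integrable setT (EFin \o (phi : borel M -> R)).
Proof.
move=> cphi; apply: measurable_bounded_integrable => //.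
- by rewrite (le_lt_trans (probability_le1 P _)) ?ltry//; exact: measurableT.
- exact: continuous_borel_measurable.
- have [B B0 phiB] := continuous_bounded_ex cphi.
  by exists B; split => [|y By x _]; [exact: num_real|apply: le_trans (phiB x) (ltW By)].
Qed.

(** * Approximation of integrals by closed superlevel sets *)

Lemma step_sum_bounds (e y : R) (N : nat) : 0 < e -> 0 <= y ->
  \sum_(i < N) e * (i%:R * e <= y)%R%:R <= y + e /\
  (y <= N%:R * e -> y <= \sum_(i < N) e * (i%:R * e <= y)%R%:R).
Proof.
move=> e0 y0.
(* The third claim strengthens the induction: below the height [y] every term is counted, so the sum
   is exactly [N%:R * e]. *)
suff [h1 [h2 h3]] : \sum_(i < N) e * (i%:R * e <= y)%R%:R <= y + e /\
    (y <= N%:R * e -> y <= \sum_(i < N) e * (i%:R * e <= y)%R%:R) /\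
    (N%:R * e <= y -> \sum_(i < N) e * (i%:R * e <= y)%R%:R = N%:R * e) by [].
elim: N => [|N [ih1 [ih2 ih3]]].
  rewrite !big_ord0 !mul0r; split; first by rewrite addr_ge0// ltW.
  by split.
rewrite big_ord_recr/= -natr1 mulrDl mul1r.
have [Ny|yN] := leP (N%:R * e) y.
  by rewrite ih3// mulr1 lerD2r; split => //; split.
rewrite mulr0 addr0; split => //; split => [_|]; first by apply/ih2/ltW.
by move=> /le_lt_trans/(_ yN); rewrite gtrDl ltNge (ltW e0).
Qed.

Lemma Rintegral_step (P : probability (borel M) R) (e : R)
    (C : nat -> set (borel M)) (N : nat) : (forall i, measurable (C i)) ->
  P.-integrable setT (EFin \o (fun x => \sum_(i < N) e * \1_(C i) x)) /\
  \int[P]_x (\sum_(i < N) e * \1_(C i) x) = \sum_(i < N) e * fine (P (C i)).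
Proof.
move=> mC.
have int1 i : P.-integrable setT (EFin \o (\1_(C i) : borel M -> R)).
  exact: integrable_indic.
have inte i : P.-integrable setT (EFin \o (fun x => e * \1_(C i) x)).
  exact: (integrableZl measurableT e (int1 i)).
elim: N => [|N [ihi ih]].
  split; last first.
    rewrite big_ord0 -[RHS](mul0r (fine (P setT))) -Rintegral_cst//.
    by apply: eq_Rintegral => x _; rewrite big_ord0.
  have -> : (fun x => \sum_(i < 0) e * \1_(C i) x) = cst 0.
    by apply/funext => x; rewrite big_ord0.
  exact: integrable0.
have E : (fun x => \sum_(i < N.+1) e * \1_(C i) x) =
    (fun x => \sum_(i < N) e * \1_(C i) x + e * \1_(C N) x).
  by apply/funext => x; rewrite big_ord_recr.
rewrite E; split.
  exact: (integrableD measurableT ihi (inte N)).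
rewrite RintegralD// ih big_ord_recr/=; congr (_ + _).
rewrite RintegralZl//; congr (_ * _).
by rewrite /Rintegral integral_indic// setIT.
Qed.

(* The sum is the integral of a step function with values in [e * nat], which
   lies between [phi + B] and [phi + B + e]. *)
Lemma Rintegral_layers (P : probability (borel M) R) phi (B e : R) (N : nat) :
    continuous phi -> 0 < e -> (forall x, `|phi x| <= B) -> B *+ 2 <= N%:R * e ->
  \int[P]_x phi x <=
    \sum_(i < N) e * fine (P [set x | i%:R * e <= phi x + B]) - B <=
  \int[P]_x phi x + e.
Proof.
move=> cphi e0 phiB BN.
pose C i : set (borel M) := [set x | i%:R * e <= phi x + B].
have mC i : measurable (C i).
  apply: borel_closed; rewrite (_ : C i = phi @^-1` [set y | i%:R * e - B <= y]).
    apply: closed_comp; [by move=> x _; exact: cphi|exact: closed_ge].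
  by apply/seteqP; split => x; rewrite /C/= lerBlDr.
have [ints <-] := Rintegral_step P e N mC.
have intc c : P.-integrable setT (EFin \o (cst c : borel M -> R)).
  by apply: (@continuous_integrable P (cst c)); exact: cst_continuous.
have intp := continuous_integrable P cphi.
have icst c : \int[P]_x (cst c (x : borel M)) = c.
  by rewrite Rintegral_cst//= (_ : P _ = 1%E) ?mulr1//; exact: probability_setT.
have bnd x : 0 <= phi x + B /\ phi x + B <= N%:R * e.
  have := phiB x; rewrite ler_norml => /andP[? ?]; split; lra.
have ind x i : \1_(C i) x = (i%:R * e <= phi x + B)%R%:R :> R.
  by rewrite indicE; congr ((_ : bool)%:R); apply/idP/idP; rewrite inE.
have addc c : \int[P]_x (phi x + cst c x) = \int[P]_x phi x + c.
  by rewrite RintegralD// icst.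
have intD c : P.-integrable setT (EFin \o (fun x : borel M => phi x + cst c x)).
  exact: (integrableD measurableT intp (intc c)).
rewrite lerBrDr lerBlDr -addrA -!addc; apply/andP; split; apply: le_Rintegral => //.
- move=> x _; rewrite /cst; have [y0 yN] := bnd x.
  have [_ /(_ yN)] := step_sum_bounds N e0 y0.
  by under [X in _ -> _ <= X]eq_bigr do rewrite ind.
- move=> x _; rewrite /cst; have [y0 yN] := bnd x.
  have [+ _] := step_sum_bounds N e0 y0.
  under [X in _ -> X <= _]eq_bigr do rewrite ind.
  by rewrite addrA addrAC.
Qed.

(** The required properties involve finitely many closed sets at a time, so they pass to the limit
    along [F]. Countable additivity would not, hence the construction of a dominating measure. *)
Lemma ultra_closed_content (F : set_system (borel_prob M)) : UltraFilter F ->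
  exists p : closed_content, forall C, closed C ->
    (fun nu : borel_prob M => fine (nu C)) @ F --> (p C : R).
Proof.
move=> FU; pose p (C : set M) : R := lim ((fun nu : borel_prob M => fine (nu C)) @ F).
have pC (C : set M) : closed C -> (fun nu : borel_prob M => fine (nu C)) @ F --> p C.
  move=> cC; have mC := borel_closed cC.
  apply: (@ultra_cvg_bounded _ _ _ _ 1) => nu.
  rewrite ger0_norm ?fine_ge0// -lee_fin fineK ?probability_le1//.
  exact: fin_num_measure.
have fU (nu : borel_prob M) (C D : set M) : closed C -> closed D ->
    fine (nu (C `|` D)) <= fine (nu C) + fine (nu D).
  move=> cC cD; rewrite -lee_fin EFinD !fineK; last 3 first.
  - by apply: fin_num_measure; exact: borel_closed.
  - by apply: fin_num_measure; exact: borel_closed.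
  - by apply: fin_num_measure; apply: borel_closed; exact: closedU.
  by apply: measureU2; exact: borel_closed.
have pS C D : closed C -> closed D -> C `<=` D -> p C <= p D.
  move=> cC cD CD; apply: (ler_cvg_to (pC _ cC) (pC _ cD)).
  apply: nearW => nu; apply: fine_le.
  - by apply: fin_num_measure; exact: borel_closed.
  - by apply: fin_num_measure; exact: borel_closed.
  - by apply: le_measure => //; rewrite inE; exact: borel_closed.
have pU C D : closed C -> closed D -> p (C `|` D) <= p C + p D.
  move=> cC cD.
  apply: (ler_cvg_to (pC _ (closedU cC cD)) (cvgD (pC _ cC) (pC _ cD))).
  by apply: nearW => nu; exact: fU.
have pdU C D : closed C -> closed D -> C `&` D = set0 ->
    p (C `|` D) = p C + p D.
  move=> cC cD CD0; have := pC _ (closedU cC cD).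
  rewrite (_ : (fun nu : borel_prob M => fine (nu (C `|` D))) =
      (fun nu : borel_prob M => fine (nu C)) + (fun nu : borel_prob M => fine (nu D))).
    by move/(cvg_unique (@Rhausdorff R)); apply; exact: (cvgD (pC _ cC) (pC _ cD)).
  apply/funext => nu; rewrite measureU//; [|exact: borel_closed..].
  by rewrite fineD//; apply: fin_num_measure; exact: borel_closed.
have pT : p setT = 1.
  have := pC _ closedT; rewrite (_ : (fun nu : borel_prob M => _) = cst 1).
    by move/(cvg_unique (@Rhausdorff R)); apply; exact: cvg_cst.
  by apply/funext => nu; rewrite (_ : nu setT = 1%E)//; exact: probability_setT.
by exists (ClosedContent pS pU pdU pT).
Qed.

(** An argument in the style of the portmanteau theorem: integrals are approximated by sums of
    masses of closed superlevel sets, whose limits [p] are dominated by [P]. *)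
Lemma closed_dominated_weak_star (F : set_system (borel_prob M))
    (p : closed_content) (P : borel_prob M) : UltraFilter F ->
  (forall C, closed C -> (fun nu : borel_prob M => fine (nu C)) @ F --> (p C : R)) ->
  (forall C, closed C -> ((p C)%:E <= P C)%E) -> F --> P.
Proof.
move=> FU pC pP; apply: cvg_weak_star => phi0 cphi0.
have cvgI phi : continuous phi ->
    cvg ((fun nu : borel_prob M => \int[nu]_x phi x) @ F).
  move=> cphi; have [B B0 phiB] := continuous_bounded_ex cphi.
  apply: (@ultra_cvg_bounded _ _ _ _ B) => nu.
  have intp := continuous_integrable nu cphi.
  apply: le_trans (le_normr_Rintegral _ intp) _ => //.
  have -> : B = \int[nu]_x (cst B (x : borel M)).
    rewrite Rintegral_cst//= (_ : nu _ = 1%E) ?mulr1//; exact: probability_setT.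
  apply: le_Rintegral => //.
  - exact: (continuous_integrable nu (fun x => continuous_comp (cphi x) (@norm_continuous _ _ _))).
  - exact: (continuous_integrable nu (@cst_continuous _ _ B)).
(* One inequality is enough, since applying it to [- phi0] gives the other. *)
suff le_lim phi : continuous phi ->
    lim ((fun nu : borel_prob M => \int[nu]_x phi x) @ F) <= \int[P]_x phi x.
  have /cvg_ex[l lF] := cvgI _ cphi0.
  suff <- : l = \int[P]_x phi0 x by [].
  have l1 : l <= \int[P]_x phi0 x.
    by have := le_lim _ cphi0; rewrite (cvg_lim (@Rhausdorff R) lF).
  apply/eqP; rewrite eq_le l1/=.
  have cN : continuous (fun x => - phi0 x) by move=> x; apply: cvgN; exact: cphi0.
  have := le_lim _ cN.
  have N (Q : borel_prob M) : \int[Q]_x (- phi0 x) = - \int[Q]_x phi0 x.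
    under eq_Rintegral do rewrite -mulN1r.
    by rewrite RintegralZl ?mulN1r//; exact: continuous_integrable.
  rewrite N (_ : lim _ = - l) ?lerN2//; apply: cvg_lim => //.
  by under eq_fun do rewrite N; exact: cvgN.
move=> cphi; apply/ler_addgt0Pr => e e0.
have [B B0 phiB] := continuous_bounded_ex cphi.
(* Enough layers of height [e] to exhaust the range of [phi + B], contained in [[0, 2 B]]. *)
pose N := (Num.truncn (B *+ 2 / e)).+1.
have BN : B *+ 2 <= N%:R * e.
  by rewrite -ler_pdivrMr// ltW// truncnS_gt.
pose C i : set M := [set x | i%:R * e <= phi x + B].
have cC i : closed (C i).
  rewrite (_ : C i = phi @^-1` [set y | i%:R * e - B <= y]).
    apply: closed_comp; [by move=> x _; exact: cphi|exact: closed_ge].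
  by apply/seteqP; split => x; rewrite /C/= lerBlDr.
apply: (@le_trans _ _ (\sum_(i < N) e * p (C i) - B)).
  apply: (ler_cvg_to (cvgI _ cphi) (_ : (fun nu : borel_prob M =>
    \sum_(i < N) e * fine (nu (C i)) - B) @ F --> _)).
    apply: cvgB; last exact: cvg_cst.
    elim: N {BN} => [|k ih].
      by under eq_fun do rewrite big_ord0; rewrite big_ord0; exact: cvg_cst.
    under eq_fun do rewrite big_ord_recr/=; rewrite big_ord_recr/=.
    by apply: cvgD => //; apply: cvgM; [exact: cvg_cst|exact: pC].
  by apply: nearW => nu; have /andP[] := Rintegral_layers nu cphi e0 phiB BN.
have /andP[_] := Rintegral_layers P cphi e0 phiB BN.
apply: le_trans; rewrite lerD2r. apply: ler_sum => i _.
rewrite ler_pM2l// -lee_fin fineK; first exact: pP.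
by apply: fin_num_measure; exact: (borel_closed (cC i)).
Qed.

(** Every ultrafilter converges: the limits of the masses of closed sets form a content, and a
    probability dominating it is a weak* limit. *)
Lemma borel_prob_compact : compact [set: borel_prob M].
Proof.
rewrite compact_ultra => F FU _; have [p pF] := ultra_closed_content FU.
have [P pP] := closed_content_dominated p cptM uniform_regular.
exists (to_borel_prob P); split => //.
apply: (closed_dominated_weak_star FU pF) => C cC.
by rewrite /= /mborel asboolT ?pP//; exact: borel_closed.
Qed.

End weak_star.

(** * Separation and countable basis of the weak* topology *)

(** Once the functions agree, the two structures differ only in the proofs of their axioms, which
    proof irrelevance identifies. *)
Lemma eq_probability d (T : measurableType d) (R : realType)
    (P Q : probability T R) : P = Q :> (set T -> \bar R) -> P = Q.
Proof.
move: P Q => [P [[a1 a2] [a3] [a4] [a5] [a6] [a7] [a8]]].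
move=> [Q [[b1 b2] [b3] [b4] [b5] [b6] [b7] [b8]]] /= PQ; subst Q.
rewrite (Prop_irrelevance a1 b1) (Prop_irrelevance a2 b2) (Prop_irrelevance a3 b3).
rewrite (Prop_irrelevance a4 b4) (Prop_irrelevance a5 b5) (Prop_irrelevance a6 b6).
by rewrite (Prop_irrelevance a7 b7) (Prop_irrelevance a8 b8).
Qed.

Lemma borel_prob_eq {R : realType} {M : pmetricType R} (mu nu : borel_prob M) :
  (forall A : set (borel M), measurable A -> mu A = nu A) -> mu = nu.
Proof.
move=> E; apply: val_inj => /=; apply: eq_probability; apply/funext => A.
have [mA|nA] := pselect (measurable A); first exact: E.
have /asboolP -> // := bprob_nonmeasurable mu.
by have /asboolP -> // := bprob_nonmeasurable nu.
Qed.

(** * Distance to a set *)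

Section set_distance.
Context {R : realType} {M : pmetricType R}.

(** For empty [A] the infimum is infinite and [fine] returns 0; this is why [open_approx] treats the
    full set apart. *)
Definition set_dist (A : set M) (x : M) : R := fine (edist_inf A x).

Variable A : set M.
Hypothesis A0 : A !=set0.

Lemma edist_inf_fin_num x : edist_inf A x \is a fin_num.
Proof.
have [a Aa] := A0; rewrite ge0_fin_numE ?edist_inf_ge0//.
apply: (@le_lt_trans _ _ (edist (x, a))); first by apply: ereal_inf_lbound; exists a.
rewrite -ge0_fin_numE//; apply/edist_finP; exists (mdist x a + 1) => /=.
  by rewrite ltr_wpDl// mdist_ge0.
by rewrite ballEmdist/= ltrDl.
Qed.

Lemma set_dist_ge0 x : 0 <= set_dist A x.
Proof. by rewrite fine_ge0// edist_inf_ge0. Qed.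

Lemma set_dist_continuous : continuous (set_dist A).
Proof.
move=> x; apply: fine_cvg; rewrite fineK ?edist_inf_fin_num//.
exact: edist_inf_continuous.
Qed.

Lemma set_dist_lt x e : set_dist A x < e = (edist_inf A x < e%:E)%E.
Proof. by rewrite -lte_fin fineK// edist_inf_fin_num. Qed.

Lemma set_dist0 x : A x -> set_dist A x = 0.
Proof. by move=> Ax; rewrite /set_dist edist_inf0. Qed.

Lemma set_dist_eq0 x : closed A -> set_dist A x = 0 -> A x.
Proof.
move=> cA d0; apply: cA => U /nbhs_ballP[e /= e0 xeU].
have : set_dist A x < e by rewrite d0.
rewrite set_dist_lt => /ereal_inf_lt[_ [a Aa <-] /edist_lt_ball xa].
by exists a; split => //; exact: xeU.
Qed.

End set_distance.

Section separating_family.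
Context {R : realType} {M : pmetricType R}.

(* Increases to the indicator function of [U] as [k] grows, if [U] is open. *)
Definition open_approx (U : set M) (k : nat) (x : M) : R :=
  if `[< U = setT >] then 1 else Num.min 1 (k%:R * set_dist (~` U) x).

Lemma setC_neq0 (U : set M) : U <> setT -> ~` U !=set0.
Proof. by move=> UT; apply/set0P/eqP => /(congr1 setC); rewrite setCK setC0. Qed.

Lemma open_approx_continuous U k : continuous (open_approx U k).
Proof.
rewrite /open_approx; case: asboolP => UT; first exact: cst_continuous.
move=> x.
apply: (@continuous_min _ _ (cst 1) (fun x => k%:R * set_dist (~` U) x)).
  exact: cvg_cst.
by apply: cvgM; [exact: cvg_cst|apply: set_dist_continuous; exact: setC_neq0].
Qed.

Lemma open_approx_ge0 U k x : 0 <= open_approx U k x.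
Proof.
rewrite /open_approx; case: asboolP => UT //.
by rewrite le_min ler01/= mulr_ge0// set_dist_ge0.
Qed.

Lemma open_approx_nd U x : nondecreasing_seq (open_approx U ^~ x).
Proof.
move=> k l kl; rewrite /open_approx; case: asboolP => UT //.
by apply: le_min2 => //; rewrite ler_wpM2r ?set_dist_ge0// ler_nat.
Qed.

Lemma open_approx_cvg U x : open U -> open_approx U k x @[k --> \oo] --> (\1_U x : R).
Proof.
move=> oU; rewrite /open_approx; case: asboolP => UT.
  by rewrite UT indicT; exact: cvg_cst.
apply: cvg_near_cst; have [Ux|nUx] := pselect (U x); last first.
  rewrite indicE memNset//; apply: nearW => k.
  by rewrite set_dist0// mulr0 min_r.
rewrite indicE mem_set//.
have d0 : 0 < set_dist (~` U) x.
  rewrite lt_neqAle set_dist_ge0 andbT eq_sym; apply/eqP => dx.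
  exact: (set_dist_eq0 (setC_neq0 UT) (open_closedC oU) dx).
near=> k; apply/min_idPl; rewrite -ler_pdivrMr// mul1r.
by near: k; exact: nbhs_infty_ger.
Unshelve. all: by end_near. Qed.

Hypothesis cptM : compact [set: M].

(** Monotone convergence recovers the measure of [U] from the integrals of its approximations. *)
Lemma open_approx_eq_measure (P Q : probability (borel M) R) U : open U ->
  (forall k, \int[P]_x open_approx U k x = \int[Q]_x open_approx U k x) ->
  P U = Q U.
Proof.
move=> oU PQ.
have cvgP (S : probability (borel M) R) :
    (\int[S]_x (open_approx U k x)%:E)%E @[k --> \oo] --> S U.
  have -> : S U = (\int[S]_x limn (fun k => (open_approx U k x)%:E))%E.
    rewrite -[U in LHS]setIT -integral_indic//; last exact: borel_open.
    apply: eq_integral => x _; apply/esym/cvg_lim => //.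
    by apply: cvg_EFin; [exact: nearW|exact: open_approx_cvg].
  apply: cvg_monotone_convergence => //.
  - move=> k; apply/measurable_EFinP; apply: continuous_borel_measurable.
    exact: open_approx_continuous.
  - by move=> k x _; rewrite lee_fin open_approx_ge0.
  - by move=> x _ k l kl; rewrite lee_fin; exact: open_approx_nd.
have := cvgP P; rewrite (_ : (fun k => _) = (fun k => \int[Q]_x (open_approx U k x)%:E)%E).
  by move=> h; exact: (cvg_unique (@ereal_hausdorff R) h (cvgP Q)).
apply/funext => k; have fS (S : probability (borel M) R) :
    (\int[S]_x (open_approx U k x)%:E)%E \is a fin_num.
  apply: integrable_fin_num => //; apply: continuous_integrable => //.
  exact: open_approx_continuous.
rewrite -(fineK (fS P)) -(fineK (fS Q)); congr EFin; exact: PQ.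
Qed.

End separating_family.

(** * Countable separating families on compact spaces *)

Section countable_separation.
Context {R : realType} {T : topologicalType} {I : countType}.
Variable Psi : I -> T -> R.
Hypothesis Psi_continuous : forall i, continuous (Psi i).
Hypothesis Psi_separates : forall x y, (forall i, Psi i x = Psi i y) -> x = y.

Lemma separated_hausdorff : hausdorff_space T.
Proof.
move=> x y xy; apply: Psi_separates => i; apply: (@Rhausdorff R) => A B Ax By.
have [z [Az Bz]] := xy _ _ (Psi_continuous Ax) (Psi_continuous By).
by exists (Psi i z).
Qed.

Hypothesis cptT : compact [set: T].

(** Finite intersections of preimages of rational intervals form the basis. If none fitted between
    [x] and an open [U], their traces on the complement of [U] would generate a filter clustering at
    some [y] outside [U], yet some [Psi i] separates [y] from [x]. *)
Lemma separated_countable_basis : exists W : nat -> set T,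
  (forall n, open (W n)) /\
  forall x U, nbhs x U -> exists n, W n x /\ W n `<=` U.
Proof.
pose box (j : I * (rat * rat)) : set T :=
  Psi j.1 @^-1` [set y | (ratr j.2.1 < y) && (y < ratr j.2.2)].
have obox j : open (box j).
  apply: open_comp; first by move=> x _; exact: Psi_continuous.
  rewrite (_ : [set y | _] = `](ratr j.2.1 : R), (ratr j.2.2)[%classic).
    exact: interval_open.
  by apply/seteqP; split => y; rewrite /= in_itv.
pose boxes (s : seq (I * (rat * rat))) := [set x | forall j, j \in s -> box j x].
have oboxes s : open (boxes s).
  elim: s => [|j s ih].
    by rewrite (_ : boxes [::] = setT); [exact: openT|exact/seteqP].
  rewrite (_ : boxes (j :: s) = box j `&` boxes s); first exact: openI.
  apply/seteqP; split => [x xs|x [xj xs] k].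
    by split => [|k ks]; apply: xs; rewrite in_cons ?eqxx// ks orbT.
  by rewrite in_cons => /predU1P[->//|]; exact: xs.
(* The basis is enumerated through codes of lists; a number that codes no list yields the empty
   set. *)
exists (fun n => if choice.unpickle n is Some s then boxes s else set0); split.
  by move=> n; case: choice.unpickle => [s|]; [exact: oboxes|exact: open0].
move=> x V; rewrite nbhsE => -[U [oU Ux] UV].
suff [s [sx sU]] : exists s, boxes s x /\ boxes s `<=` U.
  by exists (choice.pickle s); rewrite choice.pickleK; split => //; exact: subset_trans UV.
apply: contrapT => noS.
pose F := filter_from [set s | boxes s x] (fun s => boxes s `&` ~` U).
have FF : ProperFilter F.
  apply: filter_from_proper; last first.
    move=> s sx; apply: contrapT => /set0P/negP; rewrite negbK => /eqP s0.
    apply: noS; exists s; split => // z zs; apply: contrapT => nUz.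
    by have : (boxes s `&` ~` U) z by []; rewrite s0.
  apply: filter_from_filter; first by exists [::].
  move=> s t sx tx; exists (s ++ t).
    by move=> j; rewrite mem_cat => /orP[]; [exact: sx|exact: tx].
  move=> z [st nUz]; split; split => // j js; apply: st; rewrite mem_cat js ?orbT//.
have cU : compact (~` U).
  exact: (subclosed_compact (open_closedC oU) cptT (@subsetT _ _)).
have [|y [nUy Fy]] := cU F FF.
  by exists [::] => // z [].
apply: nUy; suff <- : x = y by [].
apply: Psi_separates => i; apply: contrapT => xy.
suff [q1 [q2 [xq yq]]] : exists q1 q2 : rat, ratr q1 < Psi i x < ratr q2 /\
    (Psi i y < ratr q1 \/ ratr q2 < Psi i y).
  pose j := (i, (q1, q2)).
  have Fj : F (box j).
    by exists [:: j] => [k|z [zj _]]; [rewrite inE => /eqP ->|apply: zj; rewrite inE].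
  have [yq1|yq2] := yq.
    have : nbhs y (Psi i @^-1` [set r | r < ratr q1]).
      by apply: Psi_continuous; exact: lt_nbhsl.
    move=> /(Fy _ _ Fj)[z [/andP[h _] /= h']].
    by have := lt_trans h h'; rewrite ltxx.
  have : nbhs y (Psi i @^-1` [set r | ratr q2 < r]).
    by apply: Psi_continuous; exact: lt_nbhsr.
  move=> /(Fy _ _ Fj)[z [/andP[_ h] /= h']].
  by have := lt_trans h h'; rewrite ltxx.
(* A rational between the two values is the separating endpoint; the other endpoint is any nearby
   rational on the far side of [Psi i x]. *)
have [yx|xy'|xy'] := ltgtP (Psi i y) (Psi i x); last by rewrite xy' in xy.
  have [q1] := rat_in_itvoo yx; rewrite in_itv/= => /andP[y1 x1].
  have [q2] := rat_in_itvoo (ltr_pwDr ltr01 (lexx (Psi i x))).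
  rewrite in_itv/= => /andP[x2 _].
  by exists q1, q2; rewrite x1 x2; split => //; left.
have [q2] := rat_in_itvoo xy'; rewrite in_itv/= => /andP[x2 y2].
have [q1] := rat_in_itvoo (ltr_pwDr ltr01 (lexx (Psi i x - 1))).
rewrite subrK in_itv/= => /andP[_ x1].
by exists q1, q2; rewrite x1 x2; split => //; right.
Qed.

End countable_separation.

(** The sequence has a cluster point [x]. The sets [G k], which meet the first [k] conditions of the
    basis at [x], are neighbourhoods, so each contains terms of arbitrarily large index. *)
Lemma compact_cvg_subseq {T : topologicalType} (W : nat -> set T) (u : nat -> T) :
  compact [set: T] -> (forall n, open (W n)) ->
  (forall x U, nbhs x U -> exists n, W n x /\ W n `<=` U) ->
  exists sigma : nat -> nat, {homo sigma : i j / (i < j)%N} /\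
    exists x : T, u (sigma k) @[k --> \oo] --> x.
Proof.
move=> cptT oW baseW.
have [x [_ ux]] := cptT (u @ \oo) _ filterT.
pose G k := [set y | forall i, (i < k)%N -> W i x -> W i y].
have nG k : nbhs x (G k).
  elim: k => [|k ih]; first by apply: filterS filterT.
  have [Wkx|nWkx] := pselect (W k x).
    apply: filterS (filterI ih (open_nbhs_nbhs (conj (oW k) Wkx))).
    move=> y [Gy Wy] i; rewrite ltnS leq_eqVlt => /predU1P[->//|]; exact: Gy.
  by apply: filterS ih => y Gy i; rewrite ltnS leq_eqVlt => /predU1P[->//|]; exact: Gy.
have /choice[f fP] (Nk : nat * nat) : exists n, (Nk.1 <= n)%N /\ G Nk.2 (u n).
  have [|y [[n Nn <-] Gn]] := ux (u @` [set n | (Nk.1 <= n)%N]) (G Nk.2) _ (nG _).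
    by exists Nk.1 => // n Nn; exists n.
  by exists n.
pose sigma := fix s k := if k is k'.+1 then f ((s k').+1, k) else f (0%N, 0%N).
exists sigma; split.
  by apply: homo_ltn; [exact: ltn_trans|move=> k; have [] := fP ((sigma k).+1, k.+1)].
(* [G k.+1] constrains the basic sets of index at most [k], hence the threshold [n.+1]. *)
exists x => U /baseW[n [Wnx WU]]; exists n.+1 => // -[//|k] /= nk; apply: WU.
by have [_] := fP ((sigma k).+1, k.+1); apply.
Qed.

Section weak_star_basis.
Context {R : realType} {M : pmetricType R}.
Hypothesis cptM : compact [set: M].

(** The integrals determine the measure of finite unions of basic open sets, then of all open sets
    by increasing limits, then of Borel sets because open sets are stable under intersection. *)
Lemma countable_separating_family : exists phi : seq nat * nat -> M -> R,
  (forall i, continuous (phi i)) /\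
  forall mu nu : borel_prob M,
    (forall i, \int[mu]_x phi i x = \int[nu]_x phi i x) -> mu = nu.
Proof.
have [B /countable_injP[c cinj] [oB baseB]] := compact_second_countable cptM.
(* As [c] is injective on [B], [e n] is the basic set of code [n], or empty if there is none. *)
pose e n : set M := \bigcup_(V in [set V | B V /\ c V = n]) V.
have oe n : open (e n) by apply: bigcup_open => V [BV _]; exact: oB.
pose V (s : seq nat) := \big[setU/set0]_(i <- s) e i.
have oV s : open (V s).
  by rewrite /V; elim/big_ind : _ => //; [exact: open0|exact: openU].
exists (fun i => open_approx (V i.1) i.2); split => [i|mu nu mn].
  exact: open_approx_continuous.
have mnV s : mu (V s) = nu (V s).
  by apply: open_approx_eq_measure => // k; exact: (mn (s, k)).
have mnU U : open U -> mu U = nu U.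
  move=> oU; pose s N := [seq i <- iota 0 N | `[< e i `<=` U >]].
  have UE : U = \bigcup_N V (s N).
    apply/seteqP; split => [x Ux|x [N _]]; last first.
      rewrite /V -bigcup_seq => -[i /=]; rewrite mem_filter => /andP[/asboolP iU _].
      exact: iU.
    have [Y [BY Yx] YU] := baseB x U (open_nbhs_nbhs (conj oU Ux)).
    have eY : e (c Y) = Y.
      apply/seteqP; split => [y [Z [BZ cZ]]|y Yy]; last by exists Y.
      by rewrite (cinj Z Y) ?inE.
    exists (c Y).+1 => //; rewrite /V -bigcup_seq; exists (c Y) => /=; last by rewrite eY.
    by rewrite mem_filter mem_iota/= add0n ltnSn andbT; apply/asboolP; rewrite eY.
  have ndV : {homo (fun N => V (s N)) : k l / (k <= l)%N >-> (k <= l)%O}.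
    move=> k l kl; apply/subsetPset; rewrite /V -!bigcup_seq => x [i /=].
    rewrite mem_filter mem_iota/= add0n => /andP[iU ik] ix; exists i => //=.
    by rewrite mem_filter mem_iota/= add0n iU (leq_trans ik).
  have cvgV (P : borel_prob M) : P (V (s N)) @[N --> \oo] --> P U.
    rewrite UE; apply: (nondecreasing_cvg_mu (mu := P)) => //.
      by move=> i; apply: borel_open; exact: oV.
    by apply: borel_open; apply: bigcup_open => *; exact: oV.
  have := cvgV mu; under eq_fun do rewrite mnV.
  by move=> h; exact: (cvg_unique (@ereal_hausdorff R) h (cvgV nu)).
apply: borel_prob_eq => A mA.
apply: (@measure_unique _ R (borel M) (@open M) (fun=> setT) _ _ _ _ mu nu) => //.
- by move=> ? ?; exact: openI.
- by move=> _; exact: openT.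
- by apply/seteqP; split => // x _; exists 0%N.
- by move=> _; apply: le_lt_trans (ltry 1); apply: probability_le1.
Qed.

Lemma borel_prob_hausdorff : hausdorff_space (borel_prob M).
Proof.
have [phi [cphi sep]] := countable_separating_family.
apply: (@separated_hausdorff _ _ _ (fun i (mu : borel_prob M) => \int[mu]_x phi i x)) => // i.
exact: weak_star_eval_continuous.
Qed.

Lemma borel_prob_countable_basis : exists W : nat -> set (borel_prob M),
  (forall n, open (W n)) /\
  forall mu U, nbhs mu U -> exists n, W n mu /\ W n `<=` U.
Proof.
have [phi [cphi sep]] := countable_separating_family.
apply: (@separated_countable_basis _ _ _ (fun i (mu : borel_prob M) => \int[mu]_x phi i x)) => //.
  by move=> i; exact: weak_star_eval_continuous.
exact: borel_prob_compact.
Qed.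

End weak_star_basis.

(** * Empirical averages and basins *)

Section empirical_averages.
Context {R : realType} {M : pmetricType R} (f : borel M -> borel M).

Implicit Types phi : M -> R.

(** The mean runs over [n.+1] iterates, to match [empirical f n]. *)
Definition birkhoff_mean (phi : M -> R) (n : nat) (x : M) : R :=
  n.+1%:R^-1 * \sum_(j < n.+1) phi (iter j f x).

Lemma integral_empirical phi n x : continuous phi -> (forall y, 0 <= phi y) ->
  \int[empirical f n x]_y phi y = birkhoff_mean phi n x.
Proof.
move=> cphi phi0.
have mphi : measurable_fun setT (EFin \o (phi : borel M -> R)).
  by apply/measurable_EFinP; exact: continuous_borel_measurable.
rewrite /Rintegral (eq_measure_integral (empirical_measure f n x)); last first.
  by move=> A mA _; rewrite /= /mborel asboolT.
rewrite /empirical_measure ge0_integral_mscale//=; last by move=> y _; rewrite lee_fin.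
rewrite ge0_integral_measure_sum//=; last by move=> y _; rewrite lee_fin.
under eq_bigr do rewrite integral_dirac// diracT mul1e.
by rewrite sumEFin -EFinM.
Qed.

Hypothesis mf : measurable_fun [set: borel M] f.

Lemma measurable_iter j : measurable_fun [set: borel M] (iter j f).
Proof.
elim: j => [|j ih]; first exact: measurable_id.
exact: (measurableT_comp mf ih).
Qed.

Lemma measurable_birkhoff_mean phi n : continuous phi ->
  measurable_fun [set: borel M] (birkhoff_mean phi n).
Proof.
move=> cphi; apply: measurable_funM; first exact: measurable_cst.
apply: measurable_sum => j; apply: measurableT_comp (measurable_iter j).
exact: continuous_borel_measurable.
Qed.

Lemma measurable_cvg0 (u : nat -> borel M -> R) :
  (forall n, measurable_fun [set: borel M] (u n)) ->
  measurable [set x | u n x @[n --> \oo] --> (0 : R)].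
Proof.
(* Restricting the tolerances to [k.+1%:R^-1] makes all the set operations countable. *)
move=> mu; rewrite (_ : [set x | _] = \bigcap_(k : nat) \bigcup_N
    \bigcap_(n in [set n | (N <= n)%N]) [set x | `|u n x| < k.+1%:R^-1]).
  apply: bigcap_measurableType => k _; apply: bigcup_measurable => N _.
  apply: bigcap_measurableType => n _.
  rewrite (_ : [set x | _] = setT `&` u n @^-1` `]- k.+1%:R^-1, k.+1%:R^-1[).
    by apply: mu => //; exact: measurable_itv.
  by rewrite setTI; apply/seteqP; split => x; rewrite /= in_itv/= ltr_norml.
apply/seteqP; split => x /=.
  move=> /cvgr0Pnorm_lt ux k _.
  have [|N _ Nux] := ux k.+1%:R^-1; first by rewrite invr_gt0.
  by exists N => // n; exact: Nux.
move=> ux; apply/cvgr0Pnorm_lt => e e0.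
have [k ke] : exists k : nat, k.+1%:R^-1 < e.
  have [k _ /(_ k (leqnn k))] := near_infty_natSinv_lt (PosNum e0).
  by exists k.
have [N _ Nux] := ux k I; exists N => // n Nn.
exact: lt_trans (Nux n Nn) ke.
Qed.

End empirical_averages.

(** * Basins characterized by Birkhoff means of the distance *)

Section basin.
Context {R : realType} {M : pmetricType R} (f : borel M -> borel M).
Hypothesis cptM : compact [set: M].
Variable K : set M.
Hypothesis K0 : K !=set0.

Let visits (eps : R) (n : nat) (x : M) : R :=
  #|[pred j : 'I_n | (edist_inf K (iter j f x) < eps%:E)%E]|%:R / n%:R.

Lemma visitsE eps n x : visits eps n.+1 x =
  n.+1%:R^-1 * \sum_(j < n.+1) (set_dist K (iter j f x) < eps)%R%:R.
Proof.
rewrite /visits mulrC -sum1_card natr_sum/=; congr (_ * _).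
rewrite big_mkcond/=; apply: eq_bigr => j _.
by rewrite set_dist_lt// inE; case: ifP.
Qed.

Lemma visitsC eps n x : 1 - visits eps n.+1 x =
  n.+1%:R^-1 * \sum_(j < n.+1) (eps <= set_dist K (iter j f x))%R%:R.
Proof.
apply: (@mulfI _ n.+1%:R); first by rewrite pnatr_eq0.
rewrite visitsE mulrBr mulr1 !mulrA mulfV ?pnatr_eq0// !mul1r.
rewrite -[X in X - _](_ : \sum_(j < n.+1) 1 = _); last first.
  by rewrite sumr_const card_ord.
rewrite -sumrB; apply: eq_bigr => j _.
by rewrite ltNge; case: (eps <= _); rewrite ?subr0 ?subrr.
Qed.

(** Markov's inequality: the fraction of times spent at distance at least [eps] is [1 - visits]. *)
Lemma visits_mean_ge eps n x :
  eps * (1 - visits eps n.+1 x) <= birkhoff_mean f (set_dist K) n x.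
Proof.
rewrite visitsC /birkhoff_mean mulrCA ler_pM2l ?invr_gt0// mulr_sumr.
apply: ler_sum => j _; have [d|_] := leP eps; first by rewrite mulr1n mulr1.
by rewrite mulr0n mulr0 set_dist_ge0.
Qed.

(** Times spent within [eps] of [K] contribute less than [eps] each, the others at most [D]. *)
Lemma visits_mean_le eps n x D : 0 <= eps -> (forall y, set_dist K y <= D) ->
  birkhoff_mean f (set_dist K) n x <= eps + D * (1 - visits eps n.+1 x).
Proof.
move=> e0 dD; rewrite visitsC /birkhoff_mean mulrCA.
rewrite -[X in X + _](_ : n.+1%:R^-1 * \sum_(j < n.+1) eps = _); last first.
  by rewrite sumr_const card_ord -[eps *+ _]mulr_natl mulKf// pnatr_eq0.
rewrite -mulrDr ler_pM2l ?invr_gt0// mulr_sumr.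
rewrite -big_split/=; apply: ler_sum => j _.
have [_|d] := leP eps; last by rewrite mulr0n mulr0 addr0 ltW.
by rewrite mulr1n mulr1 (le_trans (dD _))// lerDr.
Qed.

Lemma visits_le1 eps n x : visits eps n.+1 x <= 1.
Proof.
rewrite /visits ler_pdivrMr// mul1r ler_nat.
by apply: leq_trans (max_card _) _; rewrite card_ord.
Qed.

Lemma basinP x : basin f K x <->
  birkhoff_mean f (set_dist K) n x @[n --> \oo] --> (0 : R).
Proof.
have mean_ge0 n : 0 <= birkhoff_mean f (set_dist K) n x.
  by rewrite mulr_ge0// sumr_ge0// => j _; exact: set_dist_ge0.
split=> [Bx|mean0 eps e0].
  have [D D0 dD] := continuous_bounded_ex cptM (set_dist_continuous K0).
  have {}dD y : set_dist K y <= D by apply: le_trans (dD y); exact: ler_norm.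
  apply/cvgr0Pnorm_lt => d d0.
  have d2 : 0 < d / 2 by rewrite divr_gt0.
  (* In [visits_mean_le] with tolerance [d / 2], a fraction of far times below [d / 2 / D] keeps the
     mean under [d]. *)
  have := Bx _ d2; rewrite -cvg_shiftS => /cvgrPdist_lt/(_ (d / 2 / D)).
  case=> [|N _ Nx]; first by rewrite divr_gt0.
  exists N => // n Nn; rewrite ger0_norm//.
  apply: le_lt_trans (visits_mean_le n x (ltW d2) dD) _.
  rewrite [ltRHS]splitr ltrD2l mulrC -ltr_pdivlMr//.
  exact: le_lt_trans (ler_norm _) (Nx n Nn).
rewrite -cvg_shiftS; apply/cvgrPdist_lt => d d0.
move/cvgr0Pnorm_lt : mean0 => /(_ (eps * d)).
case=> [|N _ Nx]; first by rewrite mulr_gt0.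
exists N => // n Nn; rewrite ger0_norm; last by rewrite subr_ge0 visits_le1.
rewrite -(ltr_pM2l e0); apply: le_lt_trans (visits_mean_ge eps n x) _.
exact: le_lt_trans (ler_norm _) (Nx n Nn).
Qed.

Hypothesis mf : measurable_fun [set: borel M] f.

Lemma basin_measurable : measurable (basin f K).
Proof.
rewrite (_ : basin f K = [set x | birkhoff_mean f (set_dist K) n x @[n --> \oo] --> (0 : R)]).
  apply: measurable_cvg0 => n; apply: measurable_birkhoff_mean => //.
  exact: set_dist_continuous.
by apply/seteqP; split => x /basinP.
Qed.

End basin.

(** A nonnegative function has integral 0 iff it vanishes almost everywhere, and the distance to a
    closed set vanishes exactly on it. *)
Lemma Rintegral_set_dist_eq0 {R : realType} {M : pmetricType R} (K : set M)
    (P : probability (borel M) R) : compact [set: M] -> K !=set0 -> closed K ->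
  \int[P]_x set_dist K x = 0 <-> P K = 1%E.
Proof.
move=> cptM K0 cK; have cd := set_dist_continuous K0.
have mK : measurable (K : set (borel M)) by exact: borel_closed.
have md : measurable_fun setT (EFin \o (set_dist K : borel M -> R)).
  by apply/measurable_EFinP; exact: continuous_borel_measurable.
have PKC : P K = 1%E <-> P (~` K) = 0%E.
  rewrite probability_setC//; have fK := fin_num_measure P K mK.
  rewrite -(fineK fK) -EFinB; split => [[->]|[]]; first by rewrite subrr.
  by move=> /eqP; rewrite subr_eq0 => /eqP <-.
rewrite PKC; have := ae_eq_integral_abs P measurableT md.
rewrite (_ : (\int[P]_x `|(EFin \o set_dist K) x|)%E =
    (\int[P]_x set_dist K x)%:E); last first.
  rewrite /Rintegral fineK.
    by apply: eq_integral => x _; rewrite /= ger0_norm// set_dist_ge0.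
  exact: (integrable_fin_num measurableT (continuous_integrable cptM P cd)).
move=> ae0; split.
  move=> d0; have /ae0[N [mN N0 dN]] : ((\int[P]_x set_dist K x)%:E = 0)%E by rewrite d0.
  apply/eqP; rewrite eq_le measure_ge0 andbT -N0; apply: le_measure.
  - by rewrite inE; exact: measurableC.
  - by rewrite inE.
  move=> x nKx; apply: dN => /= /(_ I) [] dx.
  exact/nKx/(set_dist_eq0 K0 cK).
move=> KC0; suff /ae0[] : ae_eq P setT (EFin \o set_dist K) (cst 0%E) by [].
exists (~` K); split => //; first exact: measurableC.
by move=> x /= nd Kx; apply: nd => _; rewrite /= set_dist0.
Qed.

(** * SRB-like measures *)

Lemma probability_setI1 d (T : measurableType d) (R : realType)
    (P : probability T R) (A B : set T) : measurable A -> measurable B ->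
  P A = 1%E -> P B = 1%E -> P (A `&` B) = 1%E.
Proof.
move=> mA mB A1 B1.
have mAB : measurable (A `&` B) by exact: measurableI.
have : (P (~` (A `&` B)) <= P (~` A) + P (~` B))%E.
  by rewrite setCI; apply: measureU2; exact: measurableC.
rewrite !probability_setC// A1 B1 subee// adde0.
rewrite leeBlDr ?add0e; last exact: fin_num_measure.
by move=> AB1; apply/eqP; rewrite eq_le AB1 probability_le1.
Qed.

Section srb_like_measures.
Context {R : realType} {M : pmetricType R} (f : borel M -> borel M).
Hypothesis cptM : compact [set: M].

Definition subseq_limit (x : borel M) (mu : borel_prob M) :=
  exists2 sigma : nat -> nat, {homo sigma : i j / (i < j)%N} &
    empirical f (sigma k) x @[k --> \oo] --> mu.

Lemma homo_ltn_ge (sigma : nat -> nat) k :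
  {homo sigma : i j / (i < j)%N} -> (k <= sigma k)%N.
Proof. by move=> hs; elim: k => // k ih; exact: leq_ltn_trans ih (hs _ _ (ltnSn k)). Qed.

Lemma homo_ltn_cvg (sigma : nat -> nat) :
  {homo sigma : i j / (i < j)%N} -> sigma @ \oo --> \oo.
Proof.
move=> hs U [N _ NU]; exists N => // k Nk; apply: NU => /=.
exact: leq_trans Nk (homo_ltn_ge k hs).
Qed.

Lemma subseq_limit_ex (tau : nat -> nat) x : {homo tau : i j / (i < j)%N} ->
  exists mu : borel_prob M, exists2 sigma : nat -> nat, {homo sigma : i j / (i < j)%N} &
    empirical f (tau (sigma k)) x @[k --> \oo] --> mu.
Proof.
move=> htau; have [W [oW baseW]] := borel_prob_countable_basis cptM.
have [sigma [hs [mu cmu]]] := compact_cvg_subseq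
  (fun k => empirical f (tau k) x) (borel_prob_compact cptM) oW baseW.
by exists mu; exists sigma.
Qed.

Lemma birkhoff_mean_cvg_integral (sigma : nat -> nat) x (mu : borel_prob M) (phi : M -> R) :
  continuous phi -> (forall y, 0 <= phi y) ->
  empirical f (sigma k) x @[k --> \oo] --> mu ->
  birkhoff_mean f phi (sigma k) x @[k --> \oo] --> \int[mu]_y phi y.
Proof.
move=> cphi phi0 cmu.
have -> : (fun k => birkhoff_mean f phi (sigma k) x) =
    (fun nu : borel_prob M => \int[nu]_y phi y) \o (fun k => empirical f (sigma k) x).
  by apply/funext => k /=; rewrite integral_empirical.
by apply: continuous_cvg => //; exact: weak_star_eval_continuous.
Qed.

(* A subsequence along which the means stay away from [0] would have a further
   subsequence converging to a measure of positive integral. *)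
Lemma birkhoff_mean_cvg0 x (phi : M -> R) :
  continuous phi -> (forall y, 0 <= phi y) ->
  (forall mu, subseq_limit x mu -> \int[mu]_y phi y = 0) ->
  birkhoff_mean f phi n x @[n --> \oo] --> (0 : R).
Proof.
move=> cphi phi0 lim0; apply/cvgr0Pnorm_lt => e e0; apply: contrapT => nlim.
have /choice[g gP] N : exists n, (N <= n)%N /\ e <= birkhoff_mean f phi n x.
  apply: contrapT => H; apply: nlim; exists N => // n /= Nn.
  rewrite ltNge; apply/negP => en; apply: H; exists n; split => //.
  rewrite ger0_norm// in en.
  by rewrite mulr_ge0// sumr_ge0.
pose tau := fix t k := if k is k'.+1 then g (t k').+1 else g 0%N.
have htau : {homo tau : i j / (i < j)%N}.
  by apply: homo_ltn; [exact: ltn_trans|move=> k; have [] := gP (tau k).+1].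
have tauP k : e <= birkhoff_mean f phi (tau k) x 
  by case: k => [|k]; [have [] := gP 0%N|have [] := gP (tau k).+1].
have [mu [sigma hs cmu]] := subseq_limit_ex x htau.
have := birkhoff_mean_cvg_integral cphi phi0 cmu.
rewrite lim0; last by exists (tau \o sigma) => // i j ij; apply: htau; exact: hs.
move=> c0; have := ler_cvg_to (cvg_cst e) c0 (nearW _ (fun k => tauP (sigma k))).
by move=> e_le0; move: e0; rewrite ltNge e_le0.
Qed.

Variables (m : probability (borel M) R) (K : set M).

(** [negligible] asks only for inclusion in a measurable null set, so the measurability of this set
    of points need not be settled. *)
Definition srb_like : set (borel_prob M) := [set mu | forall U, open U -> U mu ->
  ~ m.-negligible [set x | basin f K x /\ exists2 nu, U nu & subseq_limit x nu]].

Lemma srb_like_closed : closed srb_like.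
Proof.
move=> mu clmu U oU Umu; have [nu [Onu Unu]] := clmu U (open_nbhs_nbhs (conj oU Umu)).
exact: Onu.
Qed.

Lemma srb_like_compact : compact srb_like.
Proof.
exact: (subclosed_compact srb_like_closed (borel_prob_compact cptM) (@subsetT _ _)).
Qed.

Lemma captures_limitsE (L : set (borel_prob M)) : captures_limits f m K L <->
  m.-negligible [set x | basin f K x /\ exists2 nu, ~ L nu & subseq_limit x nu].
Proof.
split; apply: negligibleS => x /=.
  by move=> [Bx [nu nL [s hs cs]]] H; apply: nL; exact: H hs _ cs.
move=> /not_implyP[Bx /existsNP[s /not_implyP[hs /existsNP[nu /not_implyP[cs nL]]]]].
by split => //; exists nu => //; exists s.
Qed.

(* The complement of [srb_like] is a countable union of basic open sets that
   almost no point of the basin accumulates on. *)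
Lemma srb_like_captures : captures_limits f m K srb_like.
Proof.
apply/captures_limitsE; have [W [oW baseW]] := borel_prob_countable_basis cptM.
pose N (V : set (borel_prob M)) : set (borel M) :=
  [set x | basin f K x /\ exists2 nu, V nu & subseq_limit x nu].
pose G n := if `[< m.-negligible (N (W n)) >] then N (W n) else set0.
apply: (@negligibleS _ _ _ _ (\bigcup_n G n)); last first.
  apply: negligible_bigcup => n; rewrite /G; case: asboolP => //.
  by move=> _; exact: negligible_set0.
move=> x [Bx [nu /existsNP[U /not_implyP[oU /not_implyP[Unu /contrapT NU]]] xnu]].
have [n [Wnu WU]] := baseW _ _ (open_nbhs_nbhs (conj oU Unu)).
exists n => //; rewrite /G asboolT; first by split => //; exists nu.
by apply: negligibleS NU => y [By [xi Wxi yxi]]; split => //; exists xi => //; exact: WU.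
Qed.

(** Compact sets are closed in this Hausdorff space, so a measure outside [L] has the complement of
    [L] as a neighbourhood on which almost no point of the basin accumulates. *)
Lemma srb_like_min (L : set (borel_prob M)) :
  compact L -> captures_limits f m K L -> srb_like `<=` L.
Proof.
move=> cL /captures_limitsE L0 mu Omu; apply: contrapT => nLmu.
apply: (Omu (~` L)) => //; apply: closed_openC.
exact: compact_closed (borel_prob_hausdorff cptM) cL.
Qed.

Hypothesis mf : measurable_fun [set: borel M] f.

(** By compactness every point has a limit measure; were the set empty, the whole basin would be
    exceptional, hence null. *)
Lemma srb_like_neq0 : K !=set0 -> (0 < m (basin f K))%E -> srb_like !=set0.
Proof.
move=> K0 mB; apply/set0P/eqP => O0.
have /captures_limitsE H := srb_like_captures; rewrite O0 in H.
suff /negligibleP B0 : m.-negligible (basin f K).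
  by move: mB; rewrite B0 ?ltxx//; exact: basin_measurable.
apply: negligibleS H => x Bx; split => //.
by have [mu xmu] := @subseq_limit_ex id x (fun i j => id); exists mu.
Qed.

Lemma srb_like_attractor mu : K !=set0 -> closed K -> srb_like mu -> mu K = 1%E.
Proof.
move=> K0 cK; have cd := set_dist_continuous K0.
pose L := [set nu : borel_prob M | \int[nu]_x set_dist K x = 0].
have cL : closed L.
  apply: (@closed_comp _ _ (fun nu : borel_prob M => \int[nu]_x set_dist K x) [set 0]).
    by move=> nu _; exact: weak_star_eval_continuous.
  exact: closed_eq.
have /srb_like_min : compact L.
  exact: (subclosed_compact cL (borel_prob_compact cptM) (@subsetT _ _)).
suff LK : captures_limits f m K L.
  by move=> /(_ LK) OL Omu; apply/(Rintegral_set_dist_eq0 mu cptM K0 cK)/OL.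
(* There is no exceptional set here: at every point of the basin the means tend to 0 along each
   subsequence. *)
apply: aeW => x /(basinP f cptM K0) mean0 sigma hs nu cnu.
have h1 := birkhoff_mean_cvg_integral cd (set_dist_ge0 K) cnu.
have h2 := cvg_comp _ _ (homo_ltn_cvg hs) mean0.
exact: (cvg_unique (@Rhausdorff R) h1 h2).
Qed.

(** Off the null set [N], all limit measures of a point of the basin of [K] integrate the distance
    to [K'] to 0, so the point lies in the basin of [K']. *)
Lemma srb_like_basin (K' : set M) : K !=set0 -> K' !=set0 -> closed K' ->
  (forall mu, srb_like mu -> mu K' = 1%E) ->
  (m (basin f K) <= m (basin f K'))%E.
Proof.
move=> K0 K'0 cK' OK'; have cd := set_dist_continuous K'0.
have [N [mN N0 captN]] := srb_like_captures.
have mB' : measurable (basin f K') by exact: basin_measurable.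
apply: (@le_trans _ _ (m (basin f K' `|` N))); last first.
  by have := measureU2 m mB' mN; rewrite [X in (_ + X)%E]N0 adde0.
apply: le_measure; rewrite ?inE.
- exact: basin_measurable.
- exact: measurableU.
move=> x Bx; have [Nx|nNx] := pselect (N x); [by right|left].
apply/(basinP f cptM K'0); apply: birkhoff_mean_cvg0 => //.
  exact: set_dist_ge0.
move=> mu [sigma hs cs]; apply/(Rintegral_set_dist_eq0 mu cptM K'0 cK')/OK'.
apply: contrapT => nO; apply: nNx; apply: captN => /= H.
by apply: nO; exact: H Bx _ hs _ cs.
Qed.

End srb_like_measures.

(** * Existence and uniqueness of the set of SRB-like measures, with (a) to (d) *)

Theorem theorem1p11 (R : realType) (n : nat) (M : pmetricType R)
  (g : riemannian_manifold n M) (M_compact : compact [set: M])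
  (m : probability (borel M) R) (m_lebesgue : is_normalized_volume g m)
  (f : borel M -> borel M) (f_measurable : measurable_fun [set: borel M] f)
  (K : set M) (K_attractor : statistical_attractor f m K) :
  exists! O : set (borel_prob M),
    (O !=set0 /\ compact O) /\
    (* (a) *) captures_limits f m K O /\
    (* (b) *) (forall L : set (borel_prob M),
                 compact L -> captures_limits f m K L -> O `<=` L) /\
    (* (c) *) (forall mu : borel_prob M, O mu -> mu K = 1%E) /\
    (* (d) *) (forall alpha : R, 0 < alpha <= 1 ->
                 minimal_observable f m alpha K ->
                 forall K' : set M, compact K' ->
                   (forall mu : borel_prob M, O mu -> mu K' = 1%E) ->
                   K `<=` K').
Proof.
have [K0 cptK mB] := K_attractor.
have cl (C : set M) : compact C -> closed C by exact: compact_closed (@metric_hausdorff R M).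
have OK mu : srb_like f m K mu -> mu K = 1%E.
  by apply: srb_like_attractor => //; exact: cl.
have ON : srb_like f m K !=set0 by exact: srb_like_neq0.
exists (srb_like f m K); split; last first.
  (* Two sets satisfying (a) and (b) contain each other by minimality. *)
  move=> O' [[_ cO'] [aO' [bO' _]]]; apply/seteqP; split.
    exact: srb_like_min.
  apply: bO'; first exact: srb_like_compact.
  exact: srb_like_captures.
split; first by split => //; exact: srb_like_compact.
split; first exact: srb_like_captures.
split; first by move=> L; exact: srb_like_min.
split => // alpha _ [[_ _ alphaB] minK] K' cptK' OK'.
(* Minimality of [K] concerns only subsets of [K], so [K'] is replaced by its intersection with
   [K]. *)
have OKK' mu : srb_like f m K mu -> mu (K `&` K') = 1%E.
  move=> Omu; apply: probability_setI1; first exact: borel_closed (cl _ cptK).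
  - exact: borel_closed (cl _ cptK').
  - exact: OK.
  - exact: OK'.
have KK'0 : K `&` K' !=set0.
  have [mu Omu] := ON; apply/set0P/eqP => KK'0.
  by have := OKK' mu Omu; rewrite KK'0 measure0 => /eqP; rewrite eq_sym onee_eq0.
have cKK' : closed (K `&` K') by apply: closedI; exact: cl.
(* If [K] were not contained in [K'], the intersection would be a proper subset of [K] whose basin
   has at least the same measure. *)
apply: contrapT => KK'; apply: (minK (K `&` K')).
  by split => [x [] //|h]; apply: KK' => x /h[].
split => //; first exact: (subclosed_compact cKK' M_compact (@subsetT _ _)).
by apply: le_trans alphaB _; exact: srb_like_basin.
Qed.
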